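(* Let $(X,d)$ be a metric space isometric to the real line $\mathbb R$ with the usual metric $|x-y|$, and let $Y$ be an unbounded subspace of $(X,d)$. Then the following conditions are equivalent: (i) $Y$ is isometric to $\mathbb R$ or to $\mathbb R_+=[0,\infty)$ (with the usual metric); (ii) for every scaling sequence $\tilde r=(r_n)_{n\in\mathbb N}$, every pretangent space $\Omega^{Y}_{\infty,\tilde r}$ to $Y$ with respect to $\tilde r$ is isometric to $Y$.
   Context: A scaling sequence is a sequence $\tilde r=(r_n)_{n\in\mathbb N}$ of positive real numbers with $\lim_{n\to\infty} r_n=\infty$. Let $(Y,d)$ be an unbounded metric space and $p\in Y$ a fixed point. $Seq(Y,\tilde r)$ is the set of all sequences $\tilde x=(x_n)_{n\in\mathbb N}$ of points of $Y$ for which the limit $\lim_{n\to\infty} d(x_n,p)/r_n$ exists and is finite (independent of the choice of $p$). Two sequences $\tilde x,\tilde y$ of points of $Y$ are mutually stable with respect to $\tilde r$ if the limit $d_{\tilde r}(\tilde x,\tilde y)=\lim_{n\to\infty} d(x_n,y_n)/r_n$ exists and is finite. A set $F\subseteq Seq(Y,\tilde r)$ is self-stable if any two of its elements are mutually stable, and maximal self-stable if it is self-stable and every $\tilde y\in Seq(Y,\tilde r)$ either belongs to $F$ or fails to be mutually stable with some $\tilde x\in F$. If $\tilde Y_{\infty,\tilde r}$ is a maximal self-stable subset of $Seq(Y,\tilde r)$, then $d_{\tilde r}$ is a pseudometric on it; the metric identification of $(\tilde Y_{\infty,\tilde r},d_{\tilde r})$, i.e. the quotient by the relation $d_{\tilde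 r}(\tilde x,\tilde y)=0$ with the induced metric, is denoted $\Omega^{Y}_{\infty,\tilde r}$. The spaces obtained in this way (one for each maximal self-stable set) are the (asymptotically) pretangent spaces to $Y$ with respect to $\tilde r$. *)

(* Defs.v *)
From HB Require Import structures.
From mathcomp Require Import all_boot all_order all_algebra.
From mathcomp Require Import generic_quotient.
From mathcomp Require Import all_classical all_reals all_analysis.
Import Order.TTheory GRing.Theory Num.Theory.
Import numFieldNormedType.Exports.

Set Implicit Arguments.
Unset Strict Implicit.
Unset Printing Implicit Defensive.

Local Open Scope classical_set_scope.
Local Open Scope quotient_scope.
Local Open Scope ring_scope.

(* The library gives [set_type A] the pseudometric structure induced by the
   inclusion, but no distance. *)
Section subspace_metric.
Context {R : realType} {X : metricType R} (A : set X).

Let dist (x y : A) : R := mdist (set_val x) (set_val y).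

Let dist_ge0 x y : 0 <= dist x y. Proof. exact: mdist_ge0. Qed.

Let dist_positivity x y : dist x y = 0 -> x = y.
Proof. by move=> /mdist_positivity /val_inj. Qed.

Let ballEdist (x : A) d : ball x d = [set y | dist x y < d].
Proof.
have -> : ball x d = set_val @^-1` ball (set_val x) d by [].
by rewrite ballEmdist.
Qed.

HB.instance Definition _ :=
  @PseudoMetric_isMetric.Build R (set_type A) dist
    dist_ge0 dist_positivity ballEdist.

End subspace_metric.

Definition isometric {R : realType} (M N : metricType R) : Prop :=
  exists f : M -> N,
    bijective f /\ forall x y, mdist (f x) (f y) = mdist x y.

Definition unbounded {R : realType} (M : metricType R) : Prop :=
  forall K : R, exists x y : M, K < mdist x y.

Record pseudometric (R : realType) (T : Type) := Pseudometric {
  pdist :> T -> T -> R ;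
  pdistxx : forall x, pdist x x = 0 ;
  pdist_sym : forall x y, pdist x y = pdist y x ;
  pdist_triangle : forall y x z, pdist x z <= pdist x y + pdist y z
}.

Section metric_identification.
Context {R : realType} {T : choiceType} (d : pseudometric R T).

Lemma pdist_ge0 x y : 0 <= d x y.
Proof.
rewrite -(@pmulrn_lge0 _ _ 2)// -(pdistxx d x) mulr2n.
by rewrite {2}(pdist_sym d x y) pdist_triangle.
Qed.

Definition pdist_eq0 (x y : T) : bool := d x y == 0.

Lemma pdist_eq0_refl : reflexive pdist_eq0.
Proof. by move=> x; rewrite /pdist_eq0 pdistxx. Qed.

Lemma pdist_eq0_sym : symmetric pdist_eq0.
Proof. by move=> x y; rewrite /pdist_eq0 pdist_sym. Qed.

Lemma pdist_eq0_trans : transitive pdist_eq0.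
Proof.
move=> y x z /eqP xy /eqP yz; rewrite /pdist_eq0 eq_le pdist_ge0 andbT.
by rewrite (le_trans (pdist_triangle d y x z))// xy yz addr0.
Qed.

Canonical pdist_eq0_equiv :=
  EquivRel pdist_eq0 pdist_eq0_refl pdist_eq0_sym pdist_eq0_trans.

Definition metric_identification : Type := {eq_quot pdist_eq0}.

HB.instance Definition _ := Choice.on metric_identification.
HB.instance Definition _ := Quotient.on metric_identification.
HB.instance Definition _ := EqQuotient.on metric_identification.

Let Q := metric_identification.

Definition quot_dist (a b : Q) : R := d (repr a) (repr b).

Lemma quot_distE (x y : T) : quot_dist (\pi_Q x) (\pi_Q y) = d x y.
Proof.
have piK z : d (repr (\pi_Q z)) z = 0.
  by apply/eqP; rewrite -[_ == 0]/(pdist_eq0 _ _) -eqmodE reprK.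
rewrite /quot_dist; set x' := repr _; set y' := repr _.
have x'x : d x' x = 0 by exact: piK.
have y'y : d y' y = 0 by exact: piK.
apply/eqP; rewrite eq_le; apply/andP; split.
- rewrite (le_trans (pdist_triangle d x _ _))// x'x add0r.
  by rewrite (le_trans (pdist_triangle d y _ _))// (pdist_sym d y) y'y addr0.
- rewrite (le_trans (pdist_triangle d x' _ _))// (pdist_sym d x) x'x add0r.
  by rewrite (le_trans (pdist_triangle d y' _ _))// y'y addr0.
Qed.

Let quot_distxx a : quot_dist a a = 0.
Proof. exact: pdistxx. Qed.

Let quot_dist_positivity a b : quot_dist a b = 0 -> a = b.
Proof.
by move=> ab0; rewrite -(reprK a) -(reprK b); apply/eqP; rewrite eqmodE; apply/eqP.
Qed.

Let quot_dist_sym a b : quot_dist a b = quot_dist b a.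
Proof. exact: pdist_sym. Qed.

Let quot_dist_triangle b a c :
  quot_dist a c <= quot_dist a b + quot_dist b c.
Proof. exact: pdist_triangle. Qed.

HB.instance Definition _ :=
  isMetric.Build R metric_identification quot_distxx quot_dist_positivity
    quot_dist_sym quot_dist_triangle.

End metric_identification.

Section pretangent.
Context {R : realType}.

Definition scaling_sequence (r : nat -> R) : Prop :=
  (forall n, 0 < r n) /\ r n @[n --> \oo] --> +oo.

Context {M : metricType R}.
Implicit Types (p : M) (r : nat -> R) (F : set (nat -> M)).

(* [cvgn] for a real-valued sequence means that the limit exists in [R], hence
   is finite. *)
Definition Seq p r : set (nat -> M) :=
  [set x | cvgn (fun n => mdist (x n) p / r n)].

Definition mutually_stable r (x y : nat -> M) : Prop :=
  cvgn (fun n => mdist (x n) (y n) / r n).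

Definition dist_tilde r (x y : nat -> M) : R := limn (fun n => mdist (x n) (y n) / r n).

Definition self_stable r F : Prop :=
  forall x y, F x -> F y -> mutually_stable r x y.

Definition maximal_self_stable p r F : Prop :=
  [/\ F `<=` Seq p r, self_stable r F &
      forall y, Seq p r y -> F y \/ exists2 x, F x & ~ mutually_stable r x y].

Section dist_tilde_pseudometric.
Variables (p : M) (r : nat -> R) (F : set (nat -> M)).
Hypotheses (hr : scaling_sequence r) (hF : maximal_self_stable p r F).

Let d (x y : F) : R := dist_tilde r (set_val x) (set_val y).

Let cvgd (x y : F) : mutually_stable r (set_val x) (set_val y).
Proof. by case: hF => _ + _; apply; exact: set_valP. Qed.

Let dxx x : d x x = 0.
Proof.
rewrite /d /dist_tilde; under eq_fun do rewrite mdistxx mul0r.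
exact: lim_cst.
Qed.

Let d_sym x y : d x y = d y x.
Proof. by rewrite /d /dist_tilde; under eq_fun do rewrite metric_sym. Qed.

Let d_triangle y x z : d x z <= d x y + d y z.
Proof.
rewrite /d /dist_tilde -limD; [|exact: cvgd..].
apply: ler_lim; [exact: cvgd|by apply: is_cvgD; exact: cvgd|].
apply: nearW => n /=; rewrite -mulrDl ler_pM2r ?metric_triangle// invr_gt0.
exact: hr.1.
Qed.

Definition dist_tilde_pseudometric : pseudometric R F :=
  Pseudometric dxx d_sym d_triangle.

Definition pretangent_space : metricType R :=
  metric_identification dist_tilde_pseudometric.

End dist_tilde_pseudometric.

End pretangent.

(* The choice of the base point is immaterial. *)
Lemma Seq_base {R : realType} {M : metricType R} (p q : M) (r : nat -> R) :
  scaling_sequence r -> Seq p r = Seq q r.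
Proof.
move=> [r0 roo].
suff H (a b : M) : Seq a r `<=` Seq b r by apply/seteqP; split; exact: H.
move=> x xa.
have ab0 : mdist a b / r n @[n --> \oo] --> (0 : R).
  have rV0 : (r n)^-1 @[n --> \oo] --> (0 : R)
    by apply/(gtr0_cvgV0 (nearW _ r0)).
  by rewrite -(mulr0 (mdist a b)); exact: cvgMl_tmp rV0.
have e0 : (mdist (x n) b / r n - mdist (x n) a / r n) @[n --> \oo] --> (0 : R).
  apply: (@squeeze_cvgr _ _ _ _ (fun n => - (mdist a b / r n))
            (fun n => mdist a b / r n)); last 2 first.
  - by rewrite -oppr0; apply: cvgN.
  - exact: ab0.
  apply: nearW => n; rewrite -mulrBl -mulNr !ler_pM2r ?invr_gt0//.
  apply/andP; split.
  - by rewrite lerNl opprB lerBlDr (metric_sym a b) addrC metric_triangle.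
  - by rewrite lerBlDr addrC metric_triangle.
rewrite /Seq/=; have -> : (fun n => mdist (x n) b / r n) =
  (fun n => (mdist (x n) b / r n - mdist (x n) a / r n) + mdist (x n) a / r n).
  by apply/funext => n; rewrite subrK.
by apply: is_cvgD => //; apply/cvg_ex; exists 0.
Qed.

(* Main.v *)
Require Import Defs.
From mathcomp Require Import all_boot all_order all_algebra.
From mathcomp Require Import generic_quotient.
From mathcomp Require Import all_classical all_reals all_analysis.
From mathcomp Require Import ring lra.
Import Order.TTheory GRing.Theory Num.Theory.
Import numFieldNormedType.Exports.
Local Open Scope classical_set_scope.
Local Open Scope ring_scope.

(* The limit of s_n y_n / r_n, where the sign s_n is that of a fixed sequence
   with nonzero limit, is an isometric coordinate on a pretangent space; when Y
   is at bounded distance from the line, or from a half-line, it takes all real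
   values, resp. all nonnegative ones.  Hence (i) implies (ii).
   Conversely, replacing r by r / t does not change the maximal self-stable sets
   and multiplies the distances by t, so (ii) makes Y similar to itself with any
   ratio t > 0.  Similarities of subsets of the line are affine, so Y is
   invariant under a map s |-> t s + c_t for each t > 0.  Either two of these
   maps do not commute, and conjugating the translation they generate makes Y
   invariant under all translations, or they share a fixed point z and Y is a
   cone with apex z.  In both cases Y is at bounded distance from a line or a
   half-line, so its pretangent spaces, which are isometric to Y, are known. *)

(** * Coordinates on metric spaces that embed in the line *)

Definition coordinate {R : realType} {M : metricType R} (i : M -> R) : Prop :=
  forall x y, mdist x y = `|i x - i y|.

Lemma coordinate_inj {R : realType} {M : metricType R} (i : M -> R) :
  coordinate i -> injective i.
Proof.
by move=> hi x y xy; apply: mdist_positivity; rewrite hi xy subrr normr0.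
Qed.

Lemma coordinate_line (R : realType) : coordinate (fun x : R^o => x : R).
Proof.
move=> x y.
(* Both distances define the same balls, and reals with the same strict upper bounds are equal. *)
have lt_dist d : (mdist x y < d) = (`|x - y| < d).
  have : ball x d y = (mdist x y < d) :> Prop by rewrite ballEmdist.
  by rewrite -ball_normE /= => E; apply/idP/idP; rewrite E.
by apply/eqP; rewrite eq_le !leNgt lt_dist ltxx -lt_dist ltxx.
Qed.

Lemma coordinate_subspace {R : realType} {M : metricType R} (A : set M)
  (i : M -> R) : coordinate i -> coordinate (fun x : A => i (set_val x)).
Proof. by move=> hi x y; exact: hi. Qed.

Lemma coordinateB {R : realType} {M : metricType R} (i : M -> R) (c : R) :
  coordinate i -> coordinate (fun x => i x - c).
Proof. by move=> hi x y; rewrite hi; congr (`|_|); ring. Qed.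

Lemma coordinateN {R : realType} {M : metricType R} (i : M -> R) :
  coordinate i -> coordinate (fun x => - i x).
Proof. by move=> hi x y; rewrite hi -normrN; congr (`|_|); ring. Qed.

Lemma isometric_sym {R : realType} (M N : metricType R) :
  isometric M N -> isometric N M.
Proof.
move=> [f [[g fK gK] hf]]; exists g; split; first by exists f.
by move=> x y; rewrite -hf !gK.
Qed.

Lemma isometric_trans {R : realType} (M N P : metricType R) :
  isometric M N -> isometric N P -> isometric M P.
Proof.
move=> [f [bf hf]] [g [bg hg]]; exists (g \o f); split; first exact: bij_comp.
by move=> x y; rewrite /= hg hf.
Qed.

(** Isometry with a space embedded in the line becomes an equality of ranges, so that later
    arguments handle sets of reals instead of bijections. *)
Lemma isometric_coordinateP {R : realType} (M N : metricType R) (j : N -> R) :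
  coordinate j ->
  isometric M N <-> exists i : M -> R, coordinate i /\ range i = range j.
Proof.
move=> hj; split.
- move=> [f [[g fK gK] hf]]; exists (j \o f); split.
    by move=> x y; rewrite -hf hj.
  apply/seteqP; split => _ [x _ <-]; first by exists (f x).
  by exists (g x); rewrite //= gK.
- move=> [i [hi ij]].
  have /choice[f fE] x : exists y, i x = j y.
    have : range j (i x) by rewrite -ij; exists x.
    by move=> [y _ <-]; exists y.
  have /choice[g gE] x : exists y, j x = i y.
    have : range i (j x) by rewrite ij; exists x.
    by move=> [y _ <-]; exists y.
  exists f; split; last by move=> x y; rewrite hj -!fE hi.
  exists g => x.
  - by apply: (@coordinate_inj _ _ i hi); rewrite -gE -fE.
  - by apply: (@coordinate_inj _ _ j hj); rewrite -fE -gE.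
Qed.

(** Functions on [F] replace functions on the quotient: [f] takes equal values on identified
    sequences, because it determines the pseudodistance. *)
Lemma pretangent_isometricP {R : realType} {M N : metricType R} {p : M}
    {r : nat -> R} {F : set (nat -> M)} (hr : scaling_sequence r)
    (hF : maximal_self_stable p r F) (j : N -> R) :
  coordinate j ->
  isometric (pretangent_space hr hF) N <->
  exists f : F -> R,
    (forall x y, dist_tilde r (set_val x) (set_val y) = `|f x - f y|) /\
    range f = range j.
Proof.
move=> hj; rewrite (isometric_coordinateP _ _ _ hj).
set Q := pretangent_space hr hF.
have mdistE (x y : F) : mdist (\pi_Q%qT x : Q) (\pi_Q%qT y : Q) =
    dist_tilde r (set_val x) (set_val y).
  exact: (quot_distE (dist_tilde_pseudometric hr hF)).
split=> [[i [hi ij]]|[f [hf fj]]].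
- exists (fun x => i (\pi_Q%qT x : Q)); split; first by move=> x y; rewrite -hi mdistE.
  rewrite -ij; apply/seteqP; split => _ [x _ <-]; first by exists (\pi_Q%qT x).
  by exists (repr x) => //; rewrite reprK.
- exists (fun q : Q => f (repr q)); split.
    by move=> x y; rewrite -hf -mdistE !reprK.
  rewrite -fj; apply/seteqP; split => _ [x _ <-]; first by exists (repr x).
  exists (\pi_Q%qT x) => //; apply/eqP; rewrite -subr_eq0 -normr_eq0 -hf -mdistE.
  by rewrite reprK mdistxx.
Qed.

(** * Limits of sequences divided by a scaling sequence *)

Lemma cvg_div_scaling_bounded {R : realType} (r u v : nat -> R) (K l : R) :
  scaling_sequence r -> (forall n, `|u n - v n| <= K) ->
  u n / r n @[n --> \oo] --> l -> v n / r n @[n --> \oo] --> l.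
Proof.
move=> [r0 roo] uvK ul.
have rV0 : (r n)^-1 @[n --> \oo] --> (0 : R) by apply/(gtr0_cvgV0 (nearW _ r0)).
have Kr0 : K / r n @[n --> \oo] --> (0 : R).
  by rewrite -(mulr0 K); exact: cvgMl_tmp rV0.
have uv0 : (u n / r n - v n / r n) @[n --> \oo] --> (0 : R).
  apply: (@squeeze_cvgr _ _ _ _ (fun n => - (K / r n)) (fun n => K / r n)) => //.
  - apply: nearW => n; rewrite -mulrBl -mulNr !ler_pM2r ?invr_gt0//.
    by rewrite -ler_norml.
  - by rewrite -oppr0; exact: cvgN.
rewrite -[l]subr0.
have -> : (fun n => v n / r n) = (fun n => u n / r n - (u n / r n - v n / r n)).
  by apply/funext => n; rewrite subKr.
exact: cvgB.
Qed.

Lemma cvg_signed_dist {R : realType} (r s u v : nat -> R) (a b : R) :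
  (forall n, 0 < r n) -> (forall n, `|s n| = 1) ->
  s n * u n / r n @[n --> \oo] --> a -> s n * v n / r n @[n --> \oo] --> b ->
  `|u n - v n| / r n @[n --> \oo] --> `|a - b|.
Proof.
move=> r0 s1 ua vb.
have -> : (fun n => `|u n - v n| / r n) =
    (fun n => `|s n * u n / r n - s n * v n / r n|).
  apply/funext => n; rewrite -mulrBl -mulrBr !normrM s1 mul1r.
  by rewrite (gtr0_norm (x := (r n)^-1))// invr_gt0.
by apply: cvg_norm; exact: cvgB.
Qed.

Lemma maximal_self_stable_mem {R : realType} {M : metricType R} {p : M}
    {r : nat -> R} {F : set (nat -> M)} (y : nat -> M) :
  maximal_self_stable p r F -> Seq p r y ->
  (forall x, F x -> mutually_stable r x y) -> F y.
Proof.
by move=> [_ _ maxF] yr st; have [//|[x Fx]] := maxF y yr; case; exact: st.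
Qed.

(** Expanding the squares leaves [2 * x * y / r ^+ 2]; dividing by [2 * (|x| / r)] turns [x / |x|]
    into the sign [s]. *)
Lemma polarization_line {R : realFieldType} (s x y r : R) :
  x = s * `|x| -> `|x| != 0 -> r != 0 ->
  ((`|x| / r) ^+ 2 + (`|y| / r) ^+ 2 - (`|x - y| / r) ^+ 2) *
    (2 * (`|x| / r))^-1 = s * y / r.
Proof.
move=> xs x0 r0; rewrite !expr_div_n !real_normK ?num_real//.
have -> : x ^+ 2 / r ^+ 2 + y ^+ 2 / r ^+ 2 - (x - y) ^+ 2 / r ^+ 2 =
  2 * x * y / r ^+ 2 by field.
by rewrite {1}xs; field; rewrite r0.
Qed.

(** * Pretangent spaces computed from a coordinate *)

Section pretangent_of_coordinate.
Context {R : realType} {M : metricType R} {p : M} {r : nat -> R}.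
Context {F : set (nat -> M)} (hr : scaling_sequence r).
Context (hF : maximal_self_stable p r F).
Context (i : M -> R) (hi : coordinate i).

Let r0 : forall n, 0 < r n := hr.1.
Let F_Seq x : F x -> Seq p r x. Proof. by case: hF => + _ _; apply. Qed.
Let F_stable x y : F x -> F y -> mutually_stable r x y.
Proof. by case: hF => _ + _; apply. Qed.

(** The signed limit realises the pseudodistance, since a factor of modulus one disappears from
    absolute values of differences. *)
Lemma pretangent_signed {N : metricType R} (j : N -> R) (s : nat -> R) :
  coordinate j -> (forall n, `|s n| = 1) ->
  (forall y, F y <->
    exists2 t : R, range j t & s n * i (y n) / r n @[n --> \oo] --> t) ->
  (forall t, range j t -> exists y, s n * i (y n) / r n @[n --> \oo] --> t) ->
  isometric (pretangent_space hr hF) N.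
Proof.
move=> hj s1 FE surj; apply/(pretangent_isometricP _ _ _ hj).
pose f (x : F) : R := limn (fun n => s n * i (set_val x n) / r n).
have fE (x : F) t : s n * i (set_val x n) / r n @[n --> \oo] --> t -> f x = t.
  by move=> xt; exact: cvg_lim xt.
have fP (x : F) : range j (f x) /\
    s n * i (set_val x n) / r n @[n --> \oo] --> f x.
  by have /FE[t jt xt] := set_valP x; rewrite (fE _ _ xt).
exists f; split.
- move=> x y; rewrite /dist_tilde; under eq_fun do rewrite hi.
  apply: cvg_lim => //; apply: (cvg_signed_dist r s) => //.
  + exact: (fP x).2.
  + exact: (fP y).2.
- apply/seteqP; split => [_ [x _ <-]|t jt]; first exact: (fP x).1.
  have [y yt] := surj t jt.
  have Fy : F y by apply/FE; exists t.
  exists (exist _ y (mem_set Fy)) => //; exact: fE.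
Qed.

Lemma cvg_coarse (s y : nat -> R) (C t : R) :
  (forall n, `|s n| = 1) -> (forall n, `|y n - s n * t * r n| <= C) ->
  s n * y n / r n @[n --> \oo] --> t.
Proof.
move=> s1 yC; apply: (@cvg_div_scaling_bounded _ r (fun n => t * r n) _ C) => //.
  move=> n; have ss : s n * s n = 1.
    by rewrite -expr2 -real_normK ?num_real// s1 expr1n.
  have -> : t * r n - s n * y n = - (s n * (y n - s n * t * r n)).
    by rewrite mulrBr !mulrA ss mul1r opprB.
  by rewrite normrN normrM s1 mul1r.
under eq_fun do rewrite mulfK ?gt_eqF//.
exact: cvg_cst.
Qed.

Lemma pretangent_ray (C : R) :
  (forall y, 0 <= i y) -> (forall t, 0 <= t -> exists y, `|i y - t| <= C) ->
  isometric (pretangent_space hr hF) [set x : R^o | 0 <= x].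
Proof.
move=> i0 dense.
pose j (x : [set x : R^o | 0 <= x]) : R := set_val x.
have hj : coordinate j := coordinate_subspace _ _ (coordinate_line R).
have jE t : range j t <-> 0 <= t.
  split=> [[x _ <-]|t0]; first exact: (set_valP x).
  by exists (exist _ (t : R^o) (mem_set t0)).
have pi (y : nat -> M) n : `| `|i (y n) - i p| - i (y n)| <= `|i p|.
  rewrite -{2}[i (y n)]ger0_norm// (le_trans (ler_dist_dist _ _))//.
  by rewrite addrAC subrr sub0r normrN.
have FP y : F y -> exists2 t : R, 0 <= t & i (y n) / r n @[n --> \oo] --> t.
  move=> /F_Seq; rewrite /Seq/=; under eq_fun do rewrite hi.
  move=> /cvg_ex[t yt].
  have {}yt : i (y n) / r n @[n --> \oo] --> t.
    exact: cvg_div_scaling_bounded yt.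
  exists t => //; rewrite -(cvg_lim _ yt)//; apply: limr_ge.
    by apply/cvg_ex; exists t.
  by apply: nearW => n; rewrite divr_ge0// ltW.
apply: (@pretangent_signed _ j (fun=> 1)) => //.
- by move=> _; rewrite normr1.
- move=> y; have -> : (fun n => 1 * i (y n) / r n) = (fun n => i (y n) / r n).
    by apply/funext => n; rewrite mul1r.
  split=> [/FP[t t0 yt]|[t _ yt]]; first by exists t => //; apply/jE.
  apply: (maximal_self_stable_mem _ hF).
  + rewrite /Seq/=; under eq_fun do rewrite hi.
    apply/cvg_ex; exists t; apply: cvg_div_scaling_bounded yt => // n.
    by rewrite distrC.
  + move=> x /FP[u _ xu]; rewrite /mutually_stable; under eq_fun do rewrite hi.
    apply/cvg_ex; exists `|u - t|; apply: (cvg_signed_dist r (fun=> 1)) => //.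
    * by move=> _; rewrite normr1.
    * by under eq_fun do rewrite mul1r.
    * by under eq_fun do rewrite mul1r.
- move=> t /jE t0.
  have /choice[y yC] n : exists y, `|i y - t * r n| <= C.
    by apply: dense; rewrite mulr_ge0// ltW.
  exists y; apply: (@cvg_coarse _ _ C) => n; rewrite ?normr1//.
  by rewrite mul1r.
Qed.

(** Convergence of [|i (y n)| / r n] leaves signs free. A member [x] of [F] with nonzero limit fixes
    a sign at each index, and stability with [x] makes the signed limits of all members exist. *)
Lemma pretangent_line (C : R) :
  (forall t, exists y, `|i y - t| <= C) ->
  isometric (pretangent_space hr hF) R^o.
Proof.
move=> dense.
have pi (y : nat -> M) n : `| `|i (y n) - i p| - `|i (y n)| | <= `|i p|.
  rewrite (le_trans (ler_dist_dist _ _))//.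
  by rewrite addrAC subrr sub0r normrN.
have SeqE y : Seq p r y <-> cvgn (fun n => `|i (y n)| / r n).
  rewrite /Seq/=; under eq_fun do rewrite hi.
  split=> /cvg_ex[t yt]; apply/cvg_ex; exists t.
  - exact: cvg_div_scaling_bounded yt.
  - by apply: cvg_div_scaling_bounded yt => // n; rewrite distrC.
have stE x y : mutually_stable r x y <->
    cvgn (fun n => `|i (x n) - i (y n)| / r n).
  by rewrite /mutually_stable; under eq_fun do rewrite hi.
(* If all members had limit zero, a sequence [w] following [r] would be stable with each of them, so
   maximality would put it in [F], although its limit is 1. *)
have [x Fx [a a0 xa]] : exists2 x, F x &
    exists2 a : R, a != 0 & `|i (x n)| / r n @[n --> \oo] --> a.
  apply: contrapT => noF.
  have F0 x : F x -> `|i (x n)| / r n @[n --> \oo] --> (0 : R).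
    move=> Fx; have /SeqE/cvg_ex[a xa] := F_Seq _ Fx.
    have [a0|a0] := eqVneq a 0; first by rewrite -a0.
    by exfalso; apply: noF; exists x => //; exists a.
  have /choice[w wC] n : exists y, `|i y - r n| <= C by exact: dense.
  have w1 : i (w n) / r n @[n --> \oo] --> (1 : R).
    under eq_fun do rewrite -[i _]mul1r.
    apply: (@cvg_coarse (fun=> 1) _ C) => n; rewrite ?normr1//.
    by rewrite !mul1r.
  have nw1 : `|i (w n)| / r n @[n --> \oo] --> (1 : R).
    rewrite -[X in _ --> X]normr1; under eq_fun do
      rewrite -[_ ^-1]ger0_norm ?invr_ge0 ?ltW// -normrM.
    exact: cvg_norm.
  suff Fw : F w by apply: noF; exists w => //; exists 1 => //; exact: oner_neq0.
  apply: (maximal_self_stable_mem _ hF); first by apply/SeqE/cvg_ex; exists 1.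
  move=> x Fx; apply/stE/cvg_ex; exists `|0 - 1|.
  apply: (cvg_signed_dist r (fun=> 1)) => //.
  * by move=> _; rewrite normr1.
  * under eq_fun do rewrite mul1r; apply/norm_cvg0P.
    under eq_fun do rewrite normrM [X in _ * X]ger0_norm ?invr_ge0 ?ltW//.
    exact: F0.
  * by under eq_fun do rewrite mul1r.
(* A zero coordinate gets sign 1, so that [s] has modulus one at every index. *)
pose s n : R := if 0 <= i (x n) then 1 else -1.
have s1 n : `|s n| = 1 by rewrite /s; case: ifP; rewrite ?normrN normr1.
have sx n : i (x n) = s n * `|i (x n)|.
  rewrite /s; case: (leP 0 (i (x n))) => h; first by rewrite ger0_norm// mul1r.
  by rewrite ltr0_norm// mulN1r opprK.
(* By polarization, |x|, |y| and |x - y| determine the sign of y relative to x. *)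
have FP y : F y -> cvgn (fun n => s n * i (y n) / r n).
  move=> Fy; have /SeqE/cvg_ex[b yb] := F_Seq _ Fy.
  have /stE/cvg_ex[c xyc] := F_stable _ _ Fx Fy.
  apply/cvg_ex; exists ((a ^+ 2 + b ^+ 2 - c ^+ 2) * (2 * a)^-1).
  have num : ((`|i (x n)| / r n) ^+ 2 + (`|i (y n)| / r n) ^+ 2 -
      (`|i (x n) - i (y n)| / r n) ^+ 2) * (2 * (`|i (x n)| / r n))^-1
      @[n --> \oo] --> (a ^+ 2 + b ^+ 2 - c ^+ 2) * (2 * a)^-1.
    apply: cvgM.
      by apply: cvgB; [apply: cvgD|]; rewrite !expr2; apply: cvgM.
    apply: cvgV; first by rewrite mulf_neq0// pnatr_eq0.
    exact: cvgMl_tmp.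
  (* The polarization formula divides by [|i (x n)|], which is nonzero only eventually. *)
  have x0 : \forall n \near \oo, `|i (x n)| / r n != 0 by apply: cvgr_neq0 xa a0.
  apply: cvg_trans num; apply: near_eq_cvg; near=> n.
  have : `|i (x n)| / r n != 0 by near: n; exact: x0.
  rewrite mulf_eq0 negb_or => /andP[xn0 _].
  by rewrite (polarization_line (s n))// gt_eqF.
apply: (@pretangent_signed _ (fun x : R^o => x : R) s) => //.
- exact: coordinate_line.
- move=> y; split=> [/FP/cvg_ex[t yt]|[t _ yt]].
    by exists t => //; exists t.
  apply: (maximal_self_stable_mem _ hF).
  + apply/SeqE/cvg_ex; exists `|t|.
    have -> : (fun n => `|i (y n)| / r n) = (fun n => `|s n * i (y n) / r n|).
      apply/funext => n; rewrite !normrM s1 mul1r (ger0_norm (x := (r n)^-1))//.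
      by rewrite invr_ge0 ltW.
    exact: cvg_norm.
  + move=> z /FP/cvg_ex[u zu]; apply/stE/cvg_ex; exists `|u - t|.
    exact: (cvg_signed_dist r s).
- move=> t _.
  have /choice[y yC] n : exists y, `|i y - s n * t * r n| <= C by exact: dense.
  by exists y; exact: cvg_coarse yC.
Unshelve. all: by end_near. Qed.

End pretangent_of_coordinate.

(** * Existence and rescaling of maximal self-stable sets *)

Lemma mutually_stable_sym {R : realType} {M : metricType R} (r : nat -> R)
  (x y : nat -> M) : mutually_stable r x y -> mutually_stable r y x.
Proof. by rewrite /mutually_stable; under eq_fun do rewrite metric_sym. Qed.

Lemma mutually_stable_refl {R : realType} {M : metricType R} (r : nat -> R)
  (x : nat -> M) : mutually_stable r x x.
Proof.
rewrite /mutually_stable; under eq_fun do rewrite mdistxx mul0r.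
exact: is_cvg_cst.
Qed.

(** Zorn's lemma applies because two sequences in the union of a chain already lie in a common
    member of it. *)
Lemma exists_maximal_self_stable {R : realType} {M : metricType R} (p : M)
  (r : nat -> R) : exists F, maximal_self_stable p r F.
Proof.
pose P (F : set (nat -> M)) := F `<=` Seq p r /\ self_stable r F.
have [G GP chain|F [[FS Fst] maxF]] := @Zorn_bigcup _ P.
  split=> [x [F /GP[FS _] Fx]|x y [A GA Ax] [B GB By]]; first exact: FS.
  have [AB|BA] := chain _ _ GA GB.
  - by apply: (GP _ GB).2 => //; exact: AB.
  - by apply: (GP _ GA).2 => //; exact: BA.
exists F; split=> // y yS; apply: contrapT => /not_orP[nFy nst].
have st x : F x -> mutually_stable r x y.
  by move=> Fx; apply: contrapT => nxy; apply: nst; exists x.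
apply: (maxF (F `|` [set y])).
  by split=> [x Fx|FyF]; [left|apply: nFy; apply: FyF; right].
split=> [x [/FS//|->//]|x z [Fx|->] [Fz|->]].
- exact: Fst.
- exact: st.
- exact/mutually_stable_sym/st.
- exact: mutually_stable_refl.
Qed.

Lemma cvg_div_scale {R : realType} (t : R) (u r : nat -> R) (l : R) :
  u n / r n @[n --> \oo] --> l -> u n / (r n / t) @[n --> \oo] --> t * l.
Proof.
have -> : (fun n => u n / (r n / t)) = (fun n => t * (u n / r n)).
  by apply/funext => n; rewrite invf_div mulrCA.
exact: cvgMl_tmp.
Qed.

Lemma is_cvg_div_scale {R : realType} (t : R) (u r : nat -> R) :
  t != 0 -> cvgn (fun n => u n / (r n / t)) = cvgn (fun n => u n / r n).
Proof.
move=> t0; apply/propext; split=> /cvg_ex[l ul]; apply/cvg_ex.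
- exists (t^-1 * l); have := cvg_div_scale t^-1 _ _ _ ul.
  by under eq_fun do rewrite invrK divfK//.
- by exists (t * l); exact: cvg_div_scale.
Qed.

Lemma scaling_sequence_scale {R : realType} (t : R) (r : nat -> R) :
  0 < t -> scaling_sequence r -> scaling_sequence (fun n => r n / t).
Proof.
move=> t0 [r0 roo]; split=> [n|]; first by rewrite divr_gt0.
apply/cvgryPge => A; move/cvgryPge : roo => /(_ (A * t)).
by apply: filterS => n; rewrite ler_pdivlMr.
Qed.

(** Multiplication by a nonzero constant preserves the existence of finite limits in both
    directions. *)
Lemma maximal_self_stable_scale {R : realType} {M : metricType R} (p : M)
    (t : R) (r : nat -> R) (F : set (nat -> M)) : t != 0 ->
  maximal_self_stable p r F -> maximal_self_stable p (fun n => r n / t) F.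
Proof.
move=> t0.
have SeqE : Seq p (fun n => r n / t) = Seq p r.
  by apply/funext => x; rewrite /Seq/= is_cvg_div_scale.
have stE x y : mutually_stable (M := M) (fun n => r n / t) x y =
    mutually_stable r x y.
  by rewrite /mutually_stable is_cvg_div_scale.
move=> [FS st maxF]; split=> [|x y Fx Fy|y]; rewrite ?SeqE ?stE//.
  exact: st.
by move=> /maxF[|[x Fx nxy]]; [left|right; exists x; rewrite ?stE].
Qed.

(** The shift by one makes the term of index 0 positive. *)
Lemma scaling_sequence_natS (R : realType) :
  scaling_sequence (fun n => n.+1%:R : R).
Proof.
split=> [n|]; first by rewrite ltr0n.
by have := @cvgr_idn R; rewrite -(cvg_shiftS (fun n => n%:R : R)).
Qed.

(** * Similarities and dilation-invariant subsets of the line *)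

Lemma similarity_affine {R : realType} {T : Type} (f g : T -> R) (t : R)
    (x0 x1 : T) : 0 < t -> f x0 != f x1 ->
  (forall x y, `|g x - g y| = t * `|f x - f y|) ->
  exists2 e : R, e * e = 1 & exists c, forall x, g x = e * t * f x + c.
Proof.
move=> t0 f01 gf.
have sq x y : (g x - g y) ^+ 2 = t ^+ 2 * (f x - f y) ^+ 2.
  by rewrite -[LHS]real_normK ?num_real// gf exprMn real_normK ?num_real.
(* The two reference points decide whether orientation is kept or reversed. *)
pose e := (g x1 - g x0) / (t * (f x1 - f x0)).
have d0 : f x1 - f x0 != 0 by rewrite subr_eq0 eq_sym.
have t0' : t != 0 by rewrite gt_eqF.
have ee : e * e = 1.
  rewrite /e -expr2 expr_div_n sq exprMn divff// mulf_neq0// expf_neq0//.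
have eE : g x1 - g x0 = e * t * (f x1 - f x0).
  by rewrite /e -mulrA divfK// mulf_neq0.
clearbody e; exists e => //; exists (g x0 - e * t * f x0) => x.
have h0 := sq x x0; have h1 := sq x x1.
(* Polarization again: the product of increments of [g] is a combination of squared distances, which
   [f] determines. The nonzero factor [g x1 - g x0] then cancels. *)
have : 2 * (g x1 - g x0) * (g x - g x0 - e * t * (f x - f x0)) = 0.
  have -> : 2 * (g x1 - g x0) * (g x - g x0 - e * t * (f x - f x0)) =
    (g x - g x0) ^+ 2 - (g x - g x1) ^+ 2 + (g x1 - g x0) ^+ 2
    - 2 * (g x1 - g x0) * (e * t * (f x - f x0)) by ring.
  rewrite h0 h1 eE.
  have -> : 2 * (e * t * (f x1 - f x0)) * (e * t * (f x - f x0)) =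
    (e * e) * (2 * t ^+ 2 * (f x1 - f x0) * (f x - f x0)) by ring.
  have -> : (e * t * (f x1 - f x0)) ^+ 2 =
    (e * e) * (t ^+ 2 * (f x1 - f x0) ^+ 2) by ring.
  by rewrite ee; ring.
have e0 : e != 0.
  by apply/eqP => e0; move/eqP: ee; rewrite e0 mul0r eq_sym oner_eq0.
move/eqP; rewrite eE !mulf_eq0 pnatr_eq0 /=.
rewrite (negPf e0) (negPf t0') (negPf d0) /=.
by rewrite subr_eq0 => /eqP h; rewrite -[LHS](subrK (g x0)) h; ring.
Qed.

Lemma dilation_invariant_set {R : realType} (S : set R) :
  (forall t, 0 < t -> exists c, forall s, S s <-> S (t * s + c)) ->
  S !=set0 ->
  S = setT \/ exists z, forall t, 0 < t -> forall s, S s -> S (z + t * (s - z)).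
Proof.
move=> inv [p Sp].
have [c2 hc2] := inv 2 ltac:(exact: ltr0n).
(* The map of ratio 2 fixes [- c2]; the inequality says that the map of ratio [t] moves this point,
   so that the two maps do not commute. *)
have [[t [c [t0 [hc nc]]]]|fixz] := pselect (exists t c,
    0 < t /\ (forall s, S s <-> S (t * s + c)) /\ c != (1 - t) * (- c2)).
(* [d] is the constant difference between the two orders of composition. *)
- left; pose d := 2 * c + c2 - (t * c2 + c).
  have d0 : d != 0.
    apply: contra_neq nc => d0.
    by apply/eqP; rewrite -subr_eq0 -[X in _ == X]d0 /d; apply/eqP; ring.
  have Sd s : S s <-> S (s + d).
    (* [s] and [s + d] are the images of this [u] under the two compositions. *)
    pose u := (s - (t * c2 + c)) / (2 * t).
    have t0' : t != 0 by rewrite gt_eqF.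
    have -> : s + d = 2 * (t * u + c) + c2 by rewrite /d /u; field.
    have {1}-> : s = t * (2 * u + c2) + c by rewrite /u; field.
    by rewrite -hc -hc2 hc hc2.
  (* Conjugating the translation by [d] with the map of ratio [k] gives the translation by
     [k * d]. *)
  have Std k s : 0 < k -> S s <-> S (s + k * d).
    move=> k0; have [e he] := inv k k0.
    have k0' : k != 0 by rewrite gt_eqF.
    pose u := (s - e) / k.
    have -> : s + k * d = k * (u + d) + e by rewrite /u; field.
    have {1}-> : s = k * u + e by rewrite /u; field.
    by rewrite -!he.
  apply/seteqP; split=> // s _.
  have [k0|k0|k0] := ltgtP ((s - p) / d) 0.
  (* For a negative multiple of [d], the point [s] is translated to [p] instead of [p] to [s]. *)
  + apply/(Std (- ((s - p) / d)) s); first by rewrite oppr_gt0.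
    by rewrite mulNr divfK// opprB addrC subrK.
  + have := (Std _ p k0).1 Sp.
    by rewrite divfK// addrC subrK.
  + move/eqP: k0; rewrite mulf_eq0 invr_eq0 (negPf d0) orbF subr_eq0.
    by move=> /eqP ->.
- right; exists (- c2) => t t0 s Ss.
  have [c hc] := inv t t0.
  have cE : c = (1 - t) * (- c2).
    by apply/eqP; apply: contra_notT fixz => nc; exists t, c.
  by have /hc := Ss; congr (S _); rewrite cE; ring.
Qed.

(** * Self-similarity of a space isometric to all its pretangent spaces *)

Section pretangent_invariant.
Context {R : realType} {M : metricType R} (p : M).
Context (i : M -> R) (hi : coordinate i).
Context (tangent : forall (r : nat -> R) (hr : scaling_sequence r)
  (F : set (nat -> M)) (hF : maximal_self_stable p r F),
  isometric (pretangent_space hr hF) M).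

(** One set [F] serves for both [r] and [r / t]. It carries coordinates [f] and [g] with the same
    range, and distances for [g] are [t] times those for [f]; the affine map taking [f] to [g]
    therefore preserves this range. *)
Lemma range_similarity (t : R) (x0 x1 : M) : 0 < t -> i x0 != i x1 ->
  exists2 e : R, e * e = 1 &
    exists c, forall s, range i s <-> range i (e * t * s + c).
Proof.
move=> t0 x01; have t0' : t != 0 by rewrite gt_eqF.
have hr := scaling_sequence_natS R.
have [F hF] := exists_maximal_self_stable p (fun n => n.+1%:R : R).
have hrt := scaling_sequence_scale t _ t0 hr.
have hFt := maximal_self_stable_scale _ _ _ _ t0' hF.
have /(pretangent_isometricP _ _ _ hi)[f [fE fr]] := tangent _ hr _ hF.
have /(pretangent_isometricP _ _ _ hi)[g [gE gr]] := tangent _ hrt _ hFt.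
have gf x y : `|g x - g y| = t * `|f x - f y|.
  rewrite -gE -fE; apply: cvg_lim => //; apply: cvg_div_scale.
  by case: hF => _ st _; apply: st; exact: set_valP.
have [y0 _ fy0] : range f (i x0) by rewrite fr; exists x0.
have [y1 _ fy1] : range f (i x1) by rewrite fr; exists x1.
have f01 : f y0 != f y1 by rewrite fy0 fy1.
have [e ee [c gc]] := similarity_affine f g t y0 y1 t0 f01 gf.
exists e => //; exists c => s; split.
- by rewrite -{1}fr -gr => -[x _ <-]; exists x.
- rewrite -{1}gr -fr => -[x _]; rewrite gc => /addIr.
  have et0 : e * t != 0.
    rewrite mulf_neq0//; apply/eqP => e0; move/eqP: ee.
    by rewrite e0 mul0r eq_sym oner_eq0.
  by move=> /(mulfI et0) <-; exists x.
Qed.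

Lemma range_dilation (t : R) (x0 x1 : M) : 0 < t -> i x0 != i x1 ->
  exists c, forall s, range i s <-> range i (t * s + c).
Proof.
move=> t0 x01; have st0 : 0 < Num.sqrt t by rewrite sqrtr_gt0.
(* squaring a similarity makes it orientation preserving *)
have [e ee [c hc]] := range_similarity _ _ _ st0 x01.
exists (e * Num.sqrt t * c + c) => s; rewrite hc hc.
suff -> : e * Num.sqrt t * (e * Num.sqrt t * s + c) + c =
    t * s + (e * Num.sqrt t * c + c) by [].
transitivity (e * e * Num.sqrt t ^+ 2 * s + (e * Num.sqrt t * c + c)).
  by ring.
by rewrite ee mul1r sqr_sqrtr// ltW.
Qed.

End pretangent_invariant.

(** * Half-lines with a possibly missing apex, and the equivalence *)

Lemma pretangent_cone {R : realType} {M : metricType R} {p : M}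
    {r : nat -> R} {F : set (nat -> M)} (hr : scaling_sequence r)
    (hF : maximal_self_stable p r F) (i : M -> R) (z : R) :
  coordinate i -> (forall y, z <= i y) -> (forall s, z < s -> range i s) ->
  isometric (pretangent_space hr hF) [set x : R^o | 0 <= x].
Proof.
move=> hi iz zi; apply: (pretangent_ray hr hF _ (coordinateB i z hi) 1).
  by move=> y; rewrite subr_ge0.
(* The extra 1 keeps the point strictly beyond the apex even when [t] is zero; it is also the error
   bound. *)
move=> t t0; have /zi[y _ yE] : z < z + t + 1 by lra.
exists y; rewrite yE; have -> : z + t + 1 - z - t = 1 by ring.
by rewrite normr1.
Qed.

(* [R^o] is the line with the metric |x - y|, and the coercion [set_type] turns
   [Y] into the metric subspace of [X]. *)
Theorem theorem6p5 (R : realType) (X : metricType R) (Y : set X) (p : Y) :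
  isometric X R^o -> unbounded Y ->
  (isometric Y R^o \/ isometric Y [set x : R^o | 0 <= x])
  <->
  (forall (r : nat -> R) (hr : scaling_sequence r)
      (F : set (nat -> Y)) (hF : maximal_self_stable p r F),
    isometric (pretangent_space hr hF) Y).
Proof.
move=> /(isometric_coordinateP _ _ _ (coordinate_line R))[h [hh _]] unbY.
have ray_coord : coordinate
    (fun x : [set x : R^o | 0 <= x] => (set_val x : R)).
  exact: coordinate_subspace (coordinate_line R).
split=> [[] YI r hr F hF|tangent].
- apply: isometric_trans (isometric_sym _ _ YI).
  have [i [hi iE]] := (isometric_coordinateP _ _ _ (coordinate_line R)).1 YI.
  apply: (pretangent_line hr hF _ hi 0) => t.
  have [y _ <-] : range i t by rewrite iE; exists t.
  by exists y; rewrite subrr normr0.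
- apply: isometric_trans (isometric_sym _ _ YI).
  have [i [hi iE]] := (isometric_coordinateP _ _ _ ray_coord).1 YI.
  apply: (pretangent_ray hr hF _ hi 0) => [y|t t0].
    have : range i (i y) by exists y.
    rewrite iE => -[x _ <-].
    exact: (set_valP x).
  have [y _ <-] : range i t.
    by rewrite iE; exists (exist _ (t : R^o) (mem_set t0)).
  by exists y; rewrite subrr normr0.
pose i (y : Y) : R := h (set_val y).
have hi : coordinate i := coordinate_subspace _ _ hh.
have hr := scaling_sequence_natS R.
have [F hF] := exists_maximal_self_stable p (fun n => n.+1%:R : R).
(* It now suffices to identify this single pretangent space from the coarse shape of [range i]. *)
have tan := isometric_sym _ _ (tangent _ hr _ hF).
have [x0 [x1 x01]] := unbY 0.
have {}x01 : i x0 != i x1.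
  by apply: contraTneq x01 => i01; rewrite hi i01 subrr normr0 ltxx.
have dil t t0 := range_dilation p i hi tangent t x0 x1 t0 x01.
have [|iT|[z hz]] := dilation_invariant_set (range i) dil.
- by exists (i p), p.
- left; apply: isometric_trans tan _.
  apply: (pretangent_line hr hF _ hi 0) => t.
  have [y _ <-] : range i t by rewrite iT.
  by exists y; rewrite subrr normr0.
(* A positive ratio means that [u] lies on the same side of the apex as [s]; the dilation with this
   ratio carries [s] to [u]. *)
have half s u : range i s -> 0 < (u - z) / (s - z) -> range i u.
  move=> Ss uz; have sz : s - z != 0.
    by apply: contraTneq uz => ->; rewrite invr0 mulr0 ltxx.
  by have := hz _ uz _ Ss; rewrite divfK// addrC subrK.
(* Points on both sides of the apex give a line, points on one side a half-line. *)
have [[y1 zy1]|noP] := pselect (exists y, z < i y);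
    have [[y2 y2z]|noN] := pselect (exists y, i y < z).
- left; apply: isometric_trans tan _.
  apply: (pretangent_line hr hF _ hi 1) => t.
  have far u : z < u -> range i u.
    move=> zu; apply: (half (i y1)); first by exists y1.
    by rewrite divr_gt0// subr_gt0.
  have [tz|zt|->] := ltgtP t z.
  + have [||y _ <-] := half (i y2) t; first by exists y2.
      by rewrite nmulr_rgt0 ?invr_lt0 subr_lt0.
    by exists y; rewrite subrr normr0.
  + by have [y _ <-] := far _ zt; exists y; rewrite subrr normr0.
  (* The apex itself may be missing, so a point at distance 1 approximates it. *)
  + have [|y _ yE] := far (z + 1); first by rewrite ltrDl.
    by exists y; rewrite yE addrAC subrr add0r normr1.
- right; apply: isometric_trans tan _; apply: (pretangent_cone hr hF i z hi).
    by move=> y; rewrite leNgt; apply/negP => yz; apply: noN; exists y.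
  by move=> s zs; apply: (half (i y1)); [exists y1|rewrite divr_gt0// subr_gt0].
- right; apply: isometric_trans tan _.
  apply: (pretangent_cone hr hF _ (- z) (coordinateN i hi)).
    by move=> y; rewrite lerN2 leNgt; apply/negP => yz; apply: noP; exists y.
  move=> s zs; have [||y _ yE] := half (i y2) (- s); first by exists y2.
    by rewrite nmulr_rgt0 ?invr_lt0 subr_lt0// ltrNl.
  by exists y => //; rewrite yE opprK.
(* With no point on either side the space would reduce to the apex. *)
- exfalso; move/eqP: x01; apply.
  have iz y : i y = z.
    have [iy|iy|//] := ltgtP (i y) z.
    + by exfalso; apply: noN; exists y.
    + by exfalso; apply: noP; exists y.
  by rewrite !iz.
Qed.
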